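(* Let $\beta>0$ and let $(\lambda_n)_{n\in\mathbb{N}_0}$ be complex numbers with $\limsup_{n\to\infty}|\lambda_n|/n\le\beta$. Let $(a_n)_{n\in\mathbb{N}_0}$ be complex numbers and define $R^*\in[0,\infty]$ by $\frac{1}{R^*}=\limsup_{n\to\infty}\sqrt[n]{|a_n|/n!}$. If $R^*>0$, then for every $x_0\in\mathbb{C}$ the series $\sum_{n=0}^\infty a_n\Phi_{\Lambda_n}(z-x_0)$ converges absolutely and uniformly on compact subsets of the open disc with center $x_0$ and radius $\frac1\beta\ln(1+\beta R^* )$ (interpreted as $\infty$ if $R^*=\infty$).
   Context: For $\lambda_0,\dots,\lambda_n\in\mathbb{C}$ the fundamental function is the entire function $\Phi_{(\lambda_0,\dots,\lambda_n)}(z)=\frac{1}{2\pi i}\int_{|w|=R}\frac{e^{zw}}{(w-\lambda_0)\cdots(w-\lambda_n)}\,dw$, where $R>\max_j|\lambda_j|$ and the circle is positively oriented. For a sequence $(\lambda_n)$, $\Lambda_n=(\lambda_0,\dots,\lambda_n)$ and $\Phi_{\Lambda_n}=\Phi_{(\lambda_0,\dots,\lambda_n)}$. *)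

(* Defs.v *)
From Stdlib Require Import Reals Lra ClassicalEpsilon.
Open Scope R_scope.

Record Cplx := mkC { Re : R ; Im : R }.

Definition Cadd (u v : Cplx) : Cplx := mkC (Re u + Re v) (Im u + Im v).
Definition Csub (u v : Cplx) : Cplx := mkC (Re u - Re v) (Im u - Im v).
Definition Cmul (u v : Cplx) : Cplx :=
  mkC (Re u * Re v - Im u * Im v) (Re u * Im v + Im u * Re v).
Definition Cinv (u : Cplx) : Cplx :=
  let d := Re u * Re u + Im u * Im u in mkC (Re u / d) (- Im u / d).
Definition Cmod (u : Cplx) : R := sqrt (Re u * Re u + Im u * Im u).
Definition Cexp (u : Cplx) : Cplx := mkC (exp (Re u) * cos (Im u)) (exp (Re u) * sin (Im u)).

Fixpoint Cprodn (f : nat -> Cplx) (n : nat) : Cplx :=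
  match n with
  | O => f O
  | S k => Cmul (Cprodn f k) (f (S k))
  end.

Fixpoint Csumn (f : nat -> Cplx) (n : nat) : Cplx :=
  match n with
  | O => f O
  | S k => Cadd (Csumn f k) (f (S k))
  end.

Definition RInt (f : R -> R) (a b : R) : R :=
  epsilon (inhabits 0) (fun v => exists pr : Riemann_integrable f a b, RiemannInt pr = v).

(* ---------- Fundamental function ----------
   Phi lam n z = Phi_{(lam 0,...,lam n)}(z)
             = 1/(2 pi i) \oint_{|w|=Rad} e^{zw} / prod_{j<=n}(w - lam j) dw,
   with the circle parametrised by w = Rad e^{it}, t in [0,2pi], dw = i w dt,
   so that the value is (1/(2 pi)) \int_0^{2pi} e^{zw} w / prod(w - lam j) dt.
   The radius is fixed to Rad = 1 + sum_j |lam j| > max_j |lam j|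
   (the integral does not depend on the choice of such a radius). *)
Definition Phi (lam : nat -> Cplx) (n : nat) (z : Cplx) : Cplx :=
  let Rad := 1 + sum_f_R0 (fun j => Cmod (lam j)) n in
  let g (t : R) : Cplx :=
    let w := mkC (Rad * cos t) (Rad * sin t) in
    Cmul (Cmul (Cexp (Cmul z w)) w) (Cinv (Cprodn (fun j => Csub w (lam j)) n)) in
  mkC (RInt (fun t => Re (g t)) 0 (2 * PI) / (2 * PI))
      (RInt (fun t => Im (g t)) 0 (2 * PI) / (2 * PI)).

Definition limsup_le (u : nat -> R) (b : R) : Prop :=
  forall eps, eps > 0 -> exists N, forall n, (n >= N)%nat -> u n <= b + eps.

Definition is_limsup (u : nat -> R) (L : R) : Prop :=
  (forall eps, eps > 0 -> exists N, forall n, (n >= N)%nat -> u n < L + eps) /\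
  (forall eps, eps > 0 -> forall N, exists n, (n >= N)%nat /\ u n > L - eps).

Definition nroot (x : R) (n : nat) : R :=
  if Req_EM_T x 0 then 0 else Rpower x (/ INR n).

Definition Ccv (s : nat -> Cplx) (l : Cplx) : Prop :=
  forall eps, eps > 0 -> exists N, forall n, (n >= N)%nat -> Cmod (Csub (s n) l) < eps.

Definition Ccompact (K : Cplx -> Prop) : Prop :=
  forall s : nat -> Cplx, (forall n, K (s n)) ->
    exists (phi : nat -> nat) (l : Cplx),
      (forall n, (phi n < phi (S n))%nat) /\ K l /\ Ccv (fun n => s (phi n)) l.

Definition Cseries_unif_cv_on (f : nat -> Cplx -> Cplx) (K : Cplx -> Prop) : Prop :=
  exists F : Cplx -> Cplx, forall eps, eps > 0 -> exists N, forall m z, (m >= N)%nat -> K z ->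
    Cmod (Csub (Csumn (fun n => f n z) m) (F z)) < eps.

Definition abs_series_unif_cv_on (f : nat -> Cplx -> Cplx) (K : Cplx -> Prop) : Prop :=
  exists G : Cplx -> R, forall eps, eps > 0 -> exists N, forall m z, (m >= N)%nat -> K z ->
    Rabs (sum_f_R0 (fun n => Cmod (f n z)) m - G z) < eps.

(* Main.v *)
(** Fix a circle [w = r e^{it}] around [lam 0, ..., lam n] and put
    [f_k(s) = (1/2 pi) \int e^{szw} w / prod_{j<k} (w - lam j) dt]. Writing
    [w = (w - lam k) + lam k] under the integral gives
    [f_{k+1}' = z (f_k + lam k f_{k+1})], with [f_0 = 0], [f_1(0) = 1] and
    [f_k(0) = 0] for [k >= 2]. If [|lam j| <= c + g j], the functions
    [F_k(x) = e^{cx} ((e^{gx} - 1) / g)^k / k!] satisfy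
    [F_k' = F_{k-1} + (c + g k) F_k], so comparing the two systems along the
    segment from [0] to [z] gives [|Phi lam n z| <= F_n(|z|)]. For [g] slightly
    larger than [beta] the terms of the series are then dominated by
    [e^{c rho} ((L + eps) (e^{g rho} - 1) / g)^n] on [|z - x0| <= rho], a geometric
    series as soon as [rho < ln (1 + beta / L) / beta]. *)

From Coquelicot Require Import Coquelicot.
Require Import Defs.
From Stdlib Require Import Reals Arith Lra Lia ClassicalEpsilon.
Open Scope R_scope.

(** * Complex numbers *)

Definition Czero : Cplx := mkC 0 0.
Definition Cone : Cplx := mkC 1 0.
Definition Copp (u : Cplx) : Cplx := mkC (- Re u) (- Im u).

Lemma Cplx_ext (u v : Cplx) : Re u = Re v -> Im u = Im v -> u = v.
Proof. destruct u, v; simpl; intros; subst; reflexivity. Qed.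

Lemma Cplx_ring_theory : ring_theory Czero Cone Cadd Cmul Csub Copp eq.
Proof. split; intros; apply Cplx_ext; simpl; ring. Qed.

Add Ring Cplx_ring : Cplx_ring_theory.

Lemma Cmod_Complex (u : Cplx) : Cmod u = Complex.Cmod (Re u, Im u).
Proof. unfold Cmod, Complex.Cmod; simpl; f_equal; ring. Qed.

Lemma Cmod_pos (u : Cplx) : 0 <= Cmod u.
Proof. apply sqrt_pos. Qed.

Lemma Cmod_mul (u v : Cplx) : Cmod (Cmul u v) = Cmod u * Cmod v.
Proof. rewrite !Cmod_Complex, <- Complex.Cmod_mult; reflexivity. Qed.

Lemma Cmod_triangle (u v : Cplx) : Cmod (Cadd u v) <= Cmod u + Cmod v.
Proof. rewrite !Cmod_Complex; exact (Complex.Cmod_triangle (Re u, Im u) (Re v, Im v)). Qed.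

Lemma Cmod_eq_0 (u : Cplx) : Cmod u = 0 -> u = Czero.
Proof.
  rewrite Cmod_Complex; intros H; apply Complex.Cmod_eq_0 in H.
  injection H; intros; apply Cplx_ext; assumption.
Qed.

Lemma Cmod_sqr (u : Cplx) : Cmod u * Cmod u = Re u * Re u + Im u * Im u.
Proof. apply sqrt_sqrt; nra. Qed.

Lemma Cmod_0 : Cmod Czero = 0.
Proof. unfold Cmod; simpl; replace (0 * 0 + 0 * 0) with 0 by ring; apply sqrt_0. Qed.

Lemma Cmod_1 : Cmod Cone = 1.
Proof. unfold Cmod; simpl; replace (1 * 1 + 0 * 0) with 1 by ring; apply sqrt_1. Qed.

Lemma Rabs_Re_le_Cmod (u : Cplx) : Rabs (Re u) <= Cmod u.
Proof. rewrite Cmod_Complex; exact (Complex.re_le_Cmod (Re u, Im u)). Qed.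

(** Multiplication by [-i] keeps the modulus and turns the imaginary part into the real part. *)
Lemma Rabs_Im_le_Cmod (u : Cplx) : Rabs (Im u) <= Cmod u.
Proof.
  pose proof (Rabs_Re_le_Cmod (Cmul (mkC 0 (-1)) u)) as H.
  rewrite Cmod_mul in H; replace (Cmod (mkC 0 (-1))) with 1 in H.
  - simpl in H; replace (0 * Re u - -1 * Im u) with (Im u) in H by ring; lra.
  - unfold Cmod; simpl; replace (0 * 0 + -1 * -1) with 1 by ring; symmetry; apply sqrt_1.
Qed.

Lemma Cmod_le_Rabs_plus (u : Cplx) : Cmod u <= Rabs (Re u) + Rabs (Im u).
Proof.
  pose proof (Rabs_pos (Re u)); pose proof (Rabs_pos (Im u)).
  apply Rsqr_incr_0; [| apply Cmod_pos | lra].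
  unfold Rsqr; rewrite Cmod_sqr.
  pose proof (Rsqr_abs (Re u)) as E1; pose proof (Rsqr_abs (Im u)) as E2.
  unfold Rsqr in *; nra.
Qed.

Lemma Cmul_integral (u v : Cplx) : Cmul u v = Czero -> u <> Czero -> v = Czero.
Proof.
  intros H Hu; apply Cmod_eq_0.
  assert (E : Cmod u * Cmod v = 0) by (rewrite <- Cmod_mul, H; apply Cmod_0).
  apply Rmult_integral in E as [E | E]; [| exact E].
  now apply Cmod_eq_0 in E.
Qed.

Lemma Cnorm2_neq0 (u : Cplx) : u <> Czero -> Re u * Re u + Im u * Im u <> 0.
Proof. intros Hu E; apply Hu; apply Cplx_ext; simpl; nra. Qed.

Lemma Cmul_inv_r (u : Cplx) : u <> Czero -> Cmul u (Cinv u) = Cone.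
Proof.
  intros Hu; apply Cnorm2_neq0 in Hu; apply Cplx_ext; simpl; field; exact Hu.
Qed.

Lemma Cinv_mul (u v : Cplx) :
  u <> Czero -> v <> Czero -> Cinv (Cmul u v) = Cmul (Cinv u) (Cinv v).
Proof.
  intros Hu Hv; apply Cnorm2_neq0 in Hu; apply Cnorm2_neq0 in Hv.
  apply Cplx_ext; simpl; field; repeat split; try assumption; nra.
Qed.

Lemma Cmod_inv_le_1 (u : Cplx) : 1 <= Cmod u -> Cmod (Cinv u) <= 1.
Proof.
  intros H.
  assert (Hu : u <> Czero) by (intros ->; rewrite Cmod_0 in H; lra).
  pose proof Cmod_1 as E; rewrite <- (Cmul_inv_r u Hu), Cmod_mul in E.
  pose proof (Cmod_pos (Cinv u)); nra.
Qed.

Lemma Cexp_0 : Cexp Czero = Cone.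
Proof. apply Cplx_ext; simpl; rewrite exp_0, ?cos_0, ?sin_0; ring. Qed.

Lemma Cmod_exp (u : Cplx) : Cmod (Cexp u) = exp (Re u).
Proof.
  unfold Cmod; simpl.
  replace (exp (Re u) * cos (Im u) * (exp (Re u) * cos (Im u)) +
           exp (Re u) * sin (Im u) * (exp (Re u) * sin (Im u)))
    with ((exp (Re u)) * (exp (Re u)) * ((sin (Im u))² + (cos (Im u))²))
    by (unfold Rsqr; ring).
  rewrite sin2_cos2, Rmult_1_r; apply sqrt_square, Rlt_le, exp_pos.
Qed.

(** * Componentwise continuity and differentiation of complex functions of a real variable *)

Definition ccont (h : R -> Cplx) : Prop :=
  continuity (fun t => Re (h t)) /\ continuity (fun t => Im (h t)).

Definition cderiv (h : R -> Cplx) (t : R) (l : Cplx) : Prop :=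
  is_derive (fun t => Re (h t)) t (Re l) /\ is_derive (fun t => Im (h t)) t (Im l).

Lemma continuity_ext (f g : R -> R) : (forall t, f t = g t) -> continuity f -> continuity g.
Proof. intros E H t; apply (continuity_pt_ext f); auto. Qed.

Lemma is_derive_continuity (f f' : R -> R) : (forall t, is_derive f t (f' t)) -> continuity f.
Proof.
  intros H t; apply continuity_pt_filterlim.
  apply (@ex_derive_continuous R_AbsRing R_NormedModule); eexists; apply H.
Qed.

Lemma cderiv_ccont (h h' : R -> Cplx) : (forall t, cderiv h t (h' t)) -> ccont h.
Proof.
  intros H; split;
    [apply (is_derive_continuity _ (fun t => Re (h' t)))
    |apply (is_derive_continuity _ (fun t => Im (h' t)))]; intros t; apply (H t).
Qed.

Lemma ccont_const (c : Cplx) : ccont (fun _ => c).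
Proof. split; apply continuity_const; intros ? ?; reflexivity. Qed.

Lemma ccont_mul (g h : R -> Cplx) : ccont g -> ccont h -> ccont (fun t => Cmul (g t) (h t)).
Proof.
  intros [g1 g2] [h1 h2]; split; simpl.
  - apply (continuity_minus (fun t => Re (g t) * Re (h t)) (fun t => Im (g t) * Im (h t)));
      now apply continuity_mult.
  - apply (continuity_plus (fun t => Re (g t) * Im (h t)) (fun t => Im (g t) * Re (h t)));
      now apply continuity_mult.
Qed.

Lemma ccont_add (g h : R -> Cplx) : ccont g -> ccont h -> ccont (fun t => Cadd (g t) (h t)).
Proof. intros [g1 g2] [h1 h2]; split; simpl; now apply continuity_plus. Qed.

Lemma ccont_sub (g h : R -> Cplx) : ccont g -> ccont h -> ccont (fun t => Csub (g t) (h t)).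
Proof. intros [g1 g2] [h1 h2]; split; simpl; now apply continuity_minus. Qed.

Lemma ccont_inv (h : R -> Cplx) : ccont h -> (forall t, h t <> Czero) -> ccont (fun t => Cinv (h t)).
Proof.
  intros [h1 h2] H0.
  assert (D : continuity (fun t => Re (h t) * Re (h t) + Im (h t) * Im (h t)))
    by (apply continuity_plus; now apply continuity_mult).
  split; simpl.
  - apply (continuity_div (fun t => Re (h t)) _ h1 D); intros t; apply Cnorm2_neq0, H0.
  - apply (continuity_div (fun t => - Im (h t)) _ (continuity_opp _ h2) D);
      intros t; apply Cnorm2_neq0, H0.
Qed.

Lemma continuity_exp : continuity exp.
Proof. apply derivable_continuous, derivable_exp. Qed.

Lemma ccont_exp (h : R -> Cplx) : ccont h -> ccont (fun t => Cexp (h t)).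
Proof.
  intros [h1 h2]; split; simpl; apply continuity_mult.
  - apply (continuity_comp _ exp h1 continuity_exp).
  - apply (continuity_comp _ cos h2 continuity_cos).
  - apply (continuity_comp _ exp h1 continuity_exp).
  - apply (continuity_comp _ sin h2 continuity_sin).
Qed.

Lemma cderiv_mul (g h : R -> Cplx) (t : R) (g' h' : Cplx) :
  cderiv g t g' -> cderiv h t h' ->
  cderiv (fun t => Cmul (g t) (h t)) t (Cadd (Cmul g' (h t)) (Cmul (g t) h')).
Proof.
  intros [g1 g2] [h1 h2]; split; simpl; evar_last.
  - apply @is_derive_minus; apply @is_derive_mult; eauto; intros; apply Rmult_comm.
  - unfold minus, plus, opp, mult; simpl; ring.
  - apply @is_derive_plus; apply @is_derive_mult; eauto; intros; apply Rmult_comm.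
  - unfold plus, mult; simpl; ring.
Qed.

Lemma cderiv_const (c : Cplx) (t : R) : cderiv (fun _ => c) t Czero.
Proof. split; apply @is_derive_const. Qed.

Lemma cderiv_exp (h : R -> Cplx) (t : R) (h' : Cplx) :
  cderiv h t h' -> cderiv (fun t => Cexp (h t)) t (Cmul h' (Cexp (h t))).
Proof.
  intros [h1 h2].
  assert (E : is_derive (fun t => exp (Re (h t))) t (Re h' * exp (Re (h t))))
    by (apply (is_derive_comp exp); [apply is_derive_exp | exact h1]).
  assert (C : is_derive (fun t => cos (Im (h t))) t (Im h' * - sin (Im (h t))))
    by (apply (is_derive_comp cos); [apply is_derive_cos | exact h2]).
  assert (S : is_derive (fun t => sin (Im (h t))) t (Im h' * cos (Im (h t))))
    by (apply (is_derive_comp sin); [apply is_derive_sin | exact h2]).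
  split; simpl; evar_last.
  - apply @is_derive_mult; eauto; intros; apply Rmult_comm.
  - unfold plus, mult; simpl; ring.
  - apply @is_derive_mult; eauto; intros; apply Rmult_comm.
  - unfold plus, mult; simpl; ring.
Qed.

(** * Mean values over the circle *)

(** Since [dw = i w dt] on the circle, the contour integral of [H(w)] with factor [1/(2 pi i)] is
    the mean of [w H(w)]. *)
Definition mean (h : R -> Cplx) : Cplx :=
  mkC (RInt.RInt (fun t => Re (h t)) 0 (2 * PI) / (2 * PI))
      (RInt.RInt (fun t => Im (h t)) 0 (2 * PI) / (2 * PI)).

Lemma two_PI_pos : 0 < 2 * PI.
Proof. pose proof PI_RGT_0; lra. Qed.

Lemma continuity_continuous (f : R -> R) (t : R) : continuity f -> continuous f t.
Proof. intros H; apply continuity_pt_filterlim, H. Qed.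

Lemma continuity_ex_RInt (f : R -> R) (a b : R) : continuity f -> ex_RInt f a b.
Proof.
  intros H; apply (@ex_RInt_continuous R_CompleteNormedModule); intros; now apply continuity_continuous.
Qed.

(** The value of [RiemannInt] does not depend on the integrability proof, so for integrable [f] the
    choice made by [epsilon] is forced. *)
Lemma Defs_RInt (f : R -> R) (a b : R) : ex_RInt f a b -> Defs.RInt f a b = RInt.RInt f a b.
Proof.
  intros H; unfold Defs.RInt.
  destruct (epsilon_spec (inhabits 0)
    (fun v => exists pr : Riemann_integrable f a b, RiemannInt pr = v)) as [pr E].
  - exists (RiemannInt (ex_RInt_Reals_0 _ _ _ H)); eexists; reflexivity.
  - rewrite <- E; symmetry; apply RInt_Reals.
Qed.

Lemma mean_ext (g h : R -> Cplx) : (forall t, g t = h t) -> mean g = mean h.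
Proof.
  intros E; apply Cplx_ext; simpl; f_equal; apply RInt_ext; intros; now rewrite E.
Qed.

Lemma mean_add (g h : R -> Cplx) :
  ccont g -> ccont h -> mean (fun t => Cadd (g t) (h t)) = Cadd (mean g) (mean h).
Proof.
  intros [g1 g2] [h1 h2]; apply Cplx_ext; simpl.
  - rewrite (RInt_plus (fun t => Re (g t)) (fun t => Re (h t))) by now apply continuity_ex_RInt.
    unfold plus; simpl; pose proof two_PI_pos; field; lra.
  - rewrite (RInt_plus (fun t => Im (g t)) (fun t => Im (h t))) by now apply continuity_ex_RInt.
    unfold plus; simpl; pose proof two_PI_pos; field; lra.
Qed.

Lemma RInt_linear_comb (f g : R -> R) (a b x y : R) : continuity f -> continuity g ->
  RInt.RInt (fun t => x * f t + y * g t) a b = x * RInt.RInt f a b + y * RInt.RInt g a b.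
Proof.
  intros Hf Hg.
  rewrite (RInt_plus (fun t => x * f t) (fun t => y * g t)).
  - rewrite (RInt_scal f), (RInt_scal g) by now apply continuity_ex_RInt. reflexivity.
  - apply continuity_ex_RInt; now apply continuity_scal.
  - apply continuity_ex_RInt; now apply continuity_scal.
Qed.

Lemma mean_mul_l (c : Cplx) (h : R -> Cplx) :
  ccont h -> mean (fun t => Cmul c (h t)) = Cmul c (mean h).
Proof.
  intros [h1 h2]; pose proof two_PI_pos; apply Cplx_ext; simpl.
  - rewrite (RInt_ext _ (fun t => Re c * Re (h t) + (- Im c) * Im (h t))) by (intros; simpl; ring).
    rewrite RInt_linear_comb by assumption; field; lra.
  - rewrite RInt_linear_comb by assumption; field; lra.
Qed.

Lemma mean_const (c : Cplx) : mean (fun _ => c) = c.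
Proof.
  pose proof two_PI_pos; apply Cplx_ext; simpl; rewrite RInt_const;
    unfold scal; simpl; unfold mult; simpl; field; lra.
Qed.

Lemma Rabs_mean_le (f : R -> R) (B : R) : continuity f -> (forall t, Rabs (f t) <= B) ->
  Rabs (RInt.RInt f 0 (2 * PI) / (2 * PI)) <= B.
Proof.
  intros Hf HB; pose proof two_PI_pos as HP.
  assert (I : Rabs (RInt.RInt f 0 (2 * PI)) <= (2 * PI - 0) * B)
    by (apply abs_RInt_le_const; [lra | now apply continuity_ex_RInt | auto]).
  unfold Rdiv; rewrite Rabs_mult, (Rabs_right (/ (2 * PI)))
    by (apply Rle_ge, Rlt_le, Rinv_0_lt_compat, HP).
  apply (Rmult_le_reg_r (2 * PI)); [exact HP |].
  rewrite Rmult_assoc, Rinv_l by lra; lra.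
Qed.

(** The factor 2 comes from bounding real and imaginary parts separately; it is harmless where the
    bound is multiplied by a geometric sequence tending to 0. *)
Lemma Cmod_mean_le (h : R -> Cplx) (B : R) :
  ccont h -> (forall t, Cmod (h t) <= B) -> Cmod (mean h) <= 2 * B.
Proof.
  intros [h1 h2] HB; eapply Rle_trans; [apply Cmod_le_Rabs_plus |]; simpl.
  assert (Rabs (RInt.RInt (fun t => Re (h t)) 0 (2 * PI) / (2 * PI)) <= B)
    by (apply Rabs_mean_le; [assumption | intros t; eapply Rle_trans; [apply Rabs_Re_le_Cmod | apply HB]]).
  assert (Rabs (RInt.RInt (fun t => Im (h t)) 0 (2 * PI) / (2 * PI)) <= B)
    by (apply Rabs_mean_le; [assumption | intros t; eapply Rle_trans; [apply Rabs_Im_le_Cmod | apply HB]]).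
  lra.
Qed.

(** The fundamental theorem of calculus over one period; this takes the place of Cauchy's theorem
    for integrands with a primitive. *)
Lemma mean_cderiv (h h' : R -> Cplx) :
  (forall t, cderiv h t (h' t)) -> ccont h' -> h (2 * PI) = h 0 -> mean h' = Czero.
Proof.
  intros D [c1 c2] E; apply Cplx_ext; simpl.
  - rewrite (is_RInt_unique _ _ _ (minus (Re (h (2 * PI))) (Re (h 0)))).
    + rewrite E; unfold minus, plus, opp; simpl; unfold Rdiv; ring.
    + apply (is_RInt_derive (fun t => Re (h t)));
        intros; [apply D | now apply continuity_continuous].
  - rewrite (is_RInt_unique _ _ _ (minus (Im (h (2 * PI))) (Im (h 0)))).
    + rewrite E; unfold minus, plus, opp; simpl; unfold Rdiv; ring.
    + apply (is_RInt_derive (fun t => Im (h t)));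
        intros; [apply D | now apply continuity_continuous].
Qed.

Lemma continuity_2d_pt_snd (f : R -> R) (x y : R) :
  continuity f -> continuity_2d_pt (fun _ v => f v) x y.
Proof.
  intros H; apply (continuity_1d_2d_pt_comp f (fun _ v => v)); [apply H | apply continuity_2d_pt_id2].
Qed.

(** The integrand is the real part of [e^{s(a+ib)} (p+iq)]. Differentiation under the integral sign
    multiplies [p+iq] by [a+ib]. *)
Lemma is_derive_RInt_exp_cos (a b p q : R -> R) (t : R) :
  continuity a -> continuity b -> continuity p -> continuity q ->
  is_derive (fun s => RInt.RInt (fun x => exp (s * a x) * (cos (s * b x) * p x - sin (s * b x) * q x)) 0 (2 * PI)) t
    (RInt.RInt (fun x => exp (t * a x) *
        (cos (t * b x) * (a x * p x - b x * q x) - sin (t * b x) * (a x * q x + b x * p x))) 0 (2 * PI)).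
Proof.
  intros ca cb cp cq.
  assert (D : forall s x, is_derive (fun s => exp (s * a x) * (cos (s * b x) * p x - sin (s * b x) * q x)) s
     (exp (s * a x) * (cos (s * b x) * (a x * p x - b x * q x) - sin (s * b x) * (a x * q x + b x * p x)))).
  { intros s x; auto_derive; [trivial | ring]. }
  evar_last.
  - apply (is_derive_RInt_param (fun s x => exp (s * a x) * (cos (s * b x) * p x - sin (s * b x) * q x))).
    + apply filter_forall; intros s x _; eexists; apply D.
    + intros x _.
      apply (continuity_2d_pt_ext (fun s x => exp (s * a x) *
        (cos (s * b x) * (a x * p x - b x * q x) - sin (s * b x) * (a x * q x + b x * p x)))).
      { intros u v; symmetry; apply is_derive_unique, D. }
      assert (sa : continuity_2d_pt (fun s x => s * a x) t x)
        by (apply continuity_2d_pt_mult; [apply continuity_2d_pt_id1 | now apply continuity_2d_pt_snd]).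
      assert (sb : continuity_2d_pt (fun s x => s * b x) t x)
        by (apply continuity_2d_pt_mult; [apply continuity_2d_pt_id1 | now apply continuity_2d_pt_snd]).
      apply continuity_2d_pt_mult; [| apply continuity_2d_pt_minus; apply continuity_2d_pt_mult].
      * apply (continuity_1d_2d_pt_comp exp); [apply continuity_exp | exact sa].
      * apply (continuity_1d_2d_pt_comp cos); [apply continuity_cos | exact sb].
      * apply (continuity_2d_pt_snd (fun x => a x * p x - b x * q x)).
        apply continuity_minus; now apply continuity_mult.
      * apply (continuity_1d_2d_pt_comp sin); [apply continuity_sin | exact sb].
      * apply (continuity_2d_pt_snd (fun x => a x * q x + b x * p x)).
        apply continuity_plus; now apply continuity_mult.
    + apply filter_forall; intros s; apply continuity_ex_RInt.
      assert (sa : continuity (fun x => s * a x)) by now apply continuity_scal.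
      assert (sb : continuity (fun x => s * b x)) by now apply continuity_scal.
      apply continuity_mult; [| apply continuity_minus; apply continuity_mult]; auto.
      * apply (continuity_comp _ exp sa continuity_exp).
      * apply (continuity_comp _ cos sb continuity_cos).
      * apply (continuity_comp _ sin sb continuity_sin).
  - apply RInt_ext; intros x _; apply is_derive_unique, D.
Qed.

Lemma cderiv_mean_exp (v q : R -> Cplx) (t : R) : ccont v -> ccont q ->
  cderiv (fun s => mean (fun x => Cmul (Cexp (Cmul (mkC s 0) (v x))) (q x))) t
    (mean (fun x => Cmul (Cexp (Cmul (mkC t 0) (v x))) (Cmul (v x) (q x)))).
Proof.
  intros [v1 v2] [q1 q2]; split; simpl.
  - assert (D := is_derive_RInt_exp_cos (fun x => Re (v x)) (fun x => Im (v x))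
                   (fun x => Re (q x)) (fun x => Im (q x)) t v1 v2 q1 q2).
    eapply is_derive_ext; [| evar_last; [apply (is_derive_scal _ _ (/ (2 * PI)) _ D) |]].
    + intros s; unfold Rdiv; rewrite Rmult_comm; f_equal; apply RInt_ext; intros x _.
      replace (s * Re (v x) - 0 * Im (v x)) with (s * Re (v x)) by ring.
      replace (s * Im (v x) + 0 * Re (v x)) with (s * Im (v x)) by ring. simpl; ring.
    + unfold Rdiv; rewrite Rmult_comm; f_equal; apply RInt_ext; intros x _.
      replace (t * Re (v x) - 0 * Im (v x)) with (t * Re (v x)) by ring.
      replace (t * Im (v x) + 0 * Re (v x)) with (t * Im (v x)) by ring. simpl; ring.
  (* The imaginary part of a number is the real part of its product with [-i], so [p+iq] is replaced
     by [q-ip]. *)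
  - assert (D := is_derive_RInt_exp_cos (fun x => Re (v x)) (fun x => Im (v x))
                   (fun x => Im (q x)) (fun x => - Re (q x)) t v1 v2 q2 (continuity_opp _ q1)).
    eapply is_derive_ext; [| evar_last; [apply (is_derive_scal _ _ (/ (2 * PI)) _ D) |]].
    + intros s; unfold Rdiv; rewrite Rmult_comm; f_equal; apply RInt_ext; intros x _.
      replace (s * Re (v x) - 0 * Im (v x)) with (s * Re (v x)) by ring.
      replace (s * Im (v x) + 0 * Re (v x)) with (s * Im (v x)) by ring. simpl; ring.
    + unfold Rdiv; rewrite Rmult_comm; f_equal; apply RInt_ext; intros x _.
      replace (t * Re (v x) - 0 * Im (v x)) with (t * Re (v x)) by ring.
      replace (t * Im (v x) + 0 * Re (v x)) with (t * Im (v x)) by ring. simpl; ring.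
Qed.

(** * Comparison for linear differential equations *)

Lemma Cauchy_Schwarz (u v : Cplx) : Re u * Re v + Im u * Im v <= Cmod u * Cmod v.
Proof.
  set (w := Cmul (mkC (Re u) (- Im u)) v).
  replace (Re u * Re v + Im u * Im v) with (Re w) by (simpl; ring).
  replace (Cmod u) with (Cmod (mkC (Re u) (- Im u))) by (unfold Cmod; simpl; f_equal; ring).
  rewrite <- Cmod_mul; fold w.
  eapply Rle_trans; [apply Rle_abs | apply Rabs_Re_le_Cmod].
Qed.

(** The mean value theorem fails for complex values, so [g] is first paired with a fixed vector [u]:
    for [Cmod u <= m] the real function [m G - <u, g>] has nonnegative derivative on [[0, T]]. *)
Lemma Cmod_increment_le (g g' : R -> Cplx) (G G' : R -> R) (T : R) : 0 <= T ->
  (forall t, cderiv g t (g' t)) -> (forall t, is_derive G t (G' t)) ->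
  (forall t, 0 <= t <= T -> Cmod (g' t) <= G' t) ->
  Cmod (Csub (g T) (g 0)) <= G T - G 0.
Proof.
  intros HT Dg DG H.
  assert (K : forall (u : Cplx) (m : R), Cmod u <= m ->
    Re u * Re (Csub (g T) (g 0)) + Im u * Im (Csub (g T) (g 0)) <= m * (G T - G 0)).
  { intros u m Hm.
    set (phi := fun t => m * G t - (Re u * Re (g t) + Im u * Im (g t))).
    assert (D : forall t, is_derive phi t (m * G' t - (Re u * Re (g' t) + Im u * Im (g' t)))).
    { intros t; apply @is_derive_minus; [| apply @is_derive_plus]; apply is_derive_scal;
        [apply DG | apply Dg | apply Dg]. }
    destruct (MVT_gen phi 0 T _ (fun t _ => D t)
      (fun t _ => is_derive_continuity _ _ D t)) as [t [Ht E]].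
    rewrite Rmin_left, Rmax_right in Ht by exact HT.
    pose proof (Cauchy_Schwarz u (g' t)); pose proof (H t Ht).
    pose proof (Cmod_pos u); pose proof (Cmod_pos (g' t)).
    assert (Cmod u * Cmod (g' t) <= m * G' t) by (apply Rmult_le_compat; assumption).
    assert (0 <= (m * G' t - (Re u * Re (g' t) + Im u * Im (g' t))) * (T - 0))
      by (apply Rmult_le_pos; lra).
    unfold phi in E; simpl; lra. }
  set (d := Csub (g T) (g 0)) in *.
  (* The choice [u = 0], [m = 1] gives [G 0 <= G T], which settles [d = 0]; the choice [u = d] gives
     [|d|^2 <= |d| (G T - G 0)], to be divided by [|d|]. *)
  pose proof (K Czero 1) as K0; rewrite Cmod_0 in K0; simpl in K0.
  pose proof (K d (Cmod d) (Rle_refl _)) as K1; rewrite <- Cmod_sqr in K1.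
  pose proof (Cmod_pos d) as [P | P]; [apply (Rmult_le_reg_l (Cmod d)); lra | lra].
Qed.

(* Variation of constants: the propagator [exp (l z (T - t))] is dominated by
   [exp (mu |z| (T - t))]. *)
Lemma linear_ode_comparison (f f1 : R -> Cplx) (z l : Cplx) (F A : R -> R) (mu : R) :
  (forall s, cderiv f s (Cmul z (Cadd (f1 s) (Cmul l (f s))))) ->
  (forall x, is_derive F x (A x + mu * F x)) ->
  (forall s, 0 <= s <= 1 -> Cmod (f1 s) <= A (s * Cmod z)) ->
  Cmod l <= mu -> Cmod (f 0) <= F 0 ->
  forall s, 0 <= s <= 1 -> Cmod (f s) <= F (s * Cmod z).
Proof.
  intros Df DF HA Hl H0 T HT.
  set (E := fun t => Cexp (mkC ((T - t) * Re (Cmul l z)) ((T - t) * Im (Cmul l z)))).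
  set (e := fun t => exp ((T - t) * (mu * Cmod z))).
  assert (HE : forall t, t <= T -> Cmod (E t) <= e t).
  { intros t Ht; unfold E, e; rewrite Cmod_exp; simpl Re at 1.
    assert (Re (Cmul l z) <= mu * Cmod z).
    { eapply Rle_trans; [apply Rle_abs |].
      eapply Rle_trans; [apply Rabs_Re_le_Cmod |].
      rewrite Cmod_mul; apply Rmult_le_compat_r; [apply Cmod_pos | exact Hl]. }
    destruct (Rle_lt_or_eq_dec ((T - t) * Re (Cmul l z)) ((T - t) * (mu * Cmod z))) as [L | L].
    - apply Rmult_le_compat_l; lra.
    - left; apply exp_increasing, L.
    - right; f_equal; exact L. }
  assert (DE : forall t, cderiv E t (Cmul (Copp (Cmul l z)) (E t))).
  { intros t; apply cderiv_exp; split; simpl; auto_derive; trivial; ring. }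
  assert (De : forall t, is_derive e t (- (mu * Cmod z) * e t)).
  { intros t; unfold e, Rminus; auto_derive; trivial; ring. }
  (* With the integrating factors the terms in [l] and [mu] cancel: [(E f)' = E z f1] and
     [(e F(t|z|))' = e |z| A(t|z|)], so only the forcing terms have to be compared. *)
  assert (I := Cmod_increment_le (fun t => Cmul (E t) (f t)) (fun t => Cmul (E t) (Cmul z (f1 t)))
    (fun t => e t * F (t * Cmod z)) (fun t => e t * (Cmod z * A (t * Cmod z))) T (proj1 HT)).
  assert (ET : E T = Cone).
  { unfold E; rewrite <- Cexp_0; f_equal; apply Cplx_ext; simpl; ring. }
  assert (eT : e T = 1) by (unfold e; rewrite <- exp_0; f_equal; ring).
  cbv beta in I; rewrite ET, eT in I.
  replace (f T) with (Cadd (Csub (Cmul Cone (f T)) (Cmul (E 0) (f 0))) (Cmul (E 0) (f 0))) by ring.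
  eapply Rle_trans; [apply Cmod_triangle |].
  rewrite Cmod_mul.
  assert (Cmod (E 0) * Cmod (f 0) <= e 0 * F 0).
  { apply Rmult_le_compat; try apply Cmod_pos; [apply HE; lra | exact H0]. }
  rewrite Rmult_0_l in I.
  assert (Cmod (Csub (Cmul Cone (f T)) (Cmul (E 0) (f 0))) <= 1 * F (T * Cmod z) - e 0 * F 0); [| lra].
  apply I.
  - intros t; pose proof (cderiv_mul _ _ _ _ _ (DE t) (Df t)) as D.
    replace (Cmul (E t) (Cmul z (f1 t))) with
      (Cadd (Cmul (Cmul (Copp (Cmul l z)) (E t)) (f t)) (Cmul (E t) (Cmul z (Cadd (f1 t) (Cmul l (f t))))))
      by ring.
    exact D.
  - intros t; evar_last.
    + apply @is_derive_mult; [apply De | | intros; apply Rmult_comm].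
      apply (is_derive_comp F (fun t => t * Cmod z)); [apply DF |].
      auto_derive; [trivial | reflexivity].
    + unfold plus, mult, scal; simpl; unfold mult; simpl; ring.
  - intros t Ht; rewrite !Cmod_mul; apply Rmult_le_compat;
      [apply Cmod_pos | apply Rmult_le_pos; apply Cmod_pos | apply HE; lra |].
    apply Rmult_le_compat_l; [apply Cmod_pos | apply HA; lra].
Qed.

(** * The contour integrals *)

Definition circle (r t : R) : Cplx := mkC (r * cos t) (r * sin t).

(** This is [1/w] for [w = r e^{it}], written without a quotient so that its derivative is
    immediate. *)
Definition circle_inv (r t : R) : Cplx := circle (/ r) (- t).

Fixpoint Cpow (u : Cplx) (n : nat) : Cplx :=
  match n with O => Cone | S m => Cmul (Cpow u m) u end.

(** Here [k] counts the factors, so the empty product is available as a start and [Phi lam n]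
    corresponds to [S n]. *)
Fixpoint inv_prod (lam : nat -> Cplx) (k : nat) (w : Cplx) : Cplx :=
  match k with
  | O => Cone
  | S j => Cmul (inv_prod lam j w) (Cinv (Csub w (lam j)))
  end.

(** The margin 1 makes every [|w - lam j|] at least 1 on the circle, so inverse products have
    modulus at most 1. The radius in [Phi] has this margin. *)
Definition encloses (r : R) (lam : nat -> Cplx) (k : nat) : Prop :=
  0 < r /\ forall j, (j < k)%nat -> Cmod (lam j) + 1 <= r.

Lemma encloses_S r lam k : encloses r lam (S k) -> encloses r lam k.
Proof. intros [H H1]; split; auto. Qed.

Lemma Cmod_circle (r t : R) : 0 < r -> Cmod (circle r t) = r.
Proof.
  intros Hr; unfold Cmod; simpl.
  replace (r * cos t * (r * cos t) + r * sin t * (r * sin t))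
    with (r * r * ((sin t)² + (cos t)²)) by (unfold Rsqr; ring).
  rewrite sin2_cos2, Rmult_1_r; apply sqrt_square; lra.
Qed.

Lemma circle_mul_inv (r t : R) : 0 < r -> Cmul (circle r t) (circle_inv r t) = Cone.
Proof.
  intros Hr; pose proof (sin2_cos2 t) as E; unfold Rsqr in E.
  unfold circle_inv, circle; rewrite cos_neg, sin_neg; apply Cplx_ext; simpl.
  - rewrite <- E; field; lra.
  - field; lra.
Qed.

Lemma cderiv_circle (r t : R) : cderiv (circle r) t (Cmul (mkC 0 1) (circle r t)).
Proof. split; simpl; auto_derive; trivial; ring. Qed.

Lemma cderiv_circle_inv (r t : R) :
  cderiv (circle_inv r) t (Cmul (mkC 0 (-1)) (circle_inv r t)).
Proof. split; unfold circle_inv; simpl; auto_derive; trivial; ring. Qed.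

Lemma ccont_circle r : ccont (circle r).
Proof. apply (cderiv_ccont _ _ (cderiv_circle r)). Qed.

Lemma ccont_circle_inv r : ccont (circle_inv r).
Proof. apply (cderiv_ccont _ _ (cderiv_circle_inv r)). Qed.

Lemma circle_2PI r : circle r (2 * PI) = circle r 0.
Proof. unfold circle; now rewrite cos_2PI, sin_2PI, cos_0, sin_0. Qed.

Lemma circle_inv_2PI r : circle_inv r (2 * PI) = circle_inv r 0.
Proof. unfold circle_inv, circle; now rewrite !cos_neg, !sin_neg, cos_2PI, sin_2PI, cos_0, sin_0. Qed.

Lemma Cmod_circle_sub (r t : R) (lam : nat -> Cplx) (k j : nat) :
  encloses r lam k -> (j < k)%nat -> 1 <= Cmod (Csub (circle r t) (lam j)).
Proof.
  intros [Hr H] Hj; specialize (H j Hj).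
  pose proof (Cmod_triangle (Csub (circle r t) (lam j)) (lam j)) as T.
  replace (Cadd (Csub (circle r t) (lam j)) (lam j)) with (circle r t) in T by ring.
  rewrite Cmod_circle in T by exact Hr; lra.
Qed.

Lemma Cmod_ge_1_neq0 u : 1 <= Cmod u -> u <> Czero.
Proof. intros H ->; rewrite Cmod_0 in H; lra. Qed.

Lemma Cmod_inv_prod_le_1 (r t : R) (lam : nat -> Cplx) (k : nat) :
  encloses r lam k -> Cmod (inv_prod lam k (circle r t)) <= 1.
Proof.
  induction k as [| k IH]; intros H; simpl; [rewrite Cmod_1; lra |].
  rewrite Cmod_mul, <- (Rmult_1_l 1).
  apply Rmult_le_compat; try apply Cmod_pos; [apply IH, encloses_S, H |].
  apply Cmod_inv_le_1, (Cmod_circle_sub _ _ _ (S k)); [exact H | lia].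
Qed.

Lemma ccont_inv_prod (r : R) (lam : nat -> Cplx) (k : nat) :
  encloses r lam k -> ccont (fun t => inv_prod lam k (circle r t)).
Proof.
  induction k as [| k IH]; intros H; simpl; [apply ccont_const |].
  apply ccont_mul; [apply IH, encloses_S, H | apply ccont_inv].
  - apply ccont_sub; [apply ccont_circle | apply ccont_const].
  - intros t; apply Cmod_ge_1_neq0, (Cmod_circle_sub _ _ _ (S k)); [exact H | lia].
Qed.

Lemma ccont_pow (h : R -> Cplx) (n : nat) : ccont h -> ccont (fun t => Cpow (h t) n).
Proof.
  intros H; induction n; simpl; [apply ccont_const | now apply ccont_mul].
Qed.

(** Splitting [w = (w - lam k) + lam k] cancels the last factor in the first term. Both the
    differential equation and the recursion for the moments rest on this identity. *)
Lemma circle_mul_inv_prod (r t : R) (lam : nat -> Cplx) (k : nat) :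
  encloses r lam (S k) ->
  Cmul (circle r t) (inv_prod lam (S k) (circle r t)) =
  Cadd (inv_prod lam k (circle r t)) (Cmul (lam k) (inv_prod lam (S k) (circle r t))).
Proof.
  intros H; simpl; set (w := circle r t).
  assert (E : Cmul (Csub w (lam k)) (Cinv (Csub w (lam k))) = Cone).
  { apply Cmul_inv_r, Cmod_ge_1_neq0, (Cmod_circle_sub _ _ _ (S k)); [exact H | lia]. }
  transitivity (Cadd (Cmul (inv_prod lam k w) (Cmul (Csub w (lam k)) (Cinv (Csub w (lam k)))))
    (Cmul (lam k) (Cmul (inv_prod lam k w) (Cinv (Csub w (lam k)))))); [ring |].
  rewrite E; ring.
Qed.

(** The derivative of [w^{-m}] in [t] is [-i m w^{-m}]; for [m = p + 1] the factor is nonzero, and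
    the mean of a derivative over a period vanishes. *)
Lemma mean_circle_inv_pow (r : R) (p : nat) :
  mean (fun t => Cpow (circle_inv r t) (S p)) = Czero.
Proof.
  assert (D : forall m t, cderiv (fun t => Cpow (circle_inv r t) m) t
     (Cmul (mkC 0 (- INR m)) (Cpow (circle_inv r t) m))).
  { intros m t; induction m as [| m IH].
    - replace (Cmul (mkC 0 (- INR 0)) (Cpow (circle_inv r t) 0)) with Czero
        by (apply Cplx_ext; simpl; ring).
      apply (cderiv_const Cone t).
    - pose proof (cderiv_mul _ _ _ _ _ IH (cderiv_circle_inv r t)) as D.
      rewrite S_INR; simpl Cpow.
      replace (mkC 0 (- (INR m + 1))) with (Cadd (mkC 0 (- INR m)) (mkC 0 (-1)))
        by (apply Cplx_ext; simpl; ring).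
      match type of D with cderiv _ _ ?l => match goal with |- cderiv _ _ ?l' =>
        replace l' with l by ring end end.
      exact D. }
  assert (P : ccont (fun t => Cpow (circle_inv r t) (S p))) by apply ccont_pow, ccont_circle_inv.
  apply (Cmul_integral (mkC 0 (- INR (S p)))).
  - rewrite <- mean_mul_l by exact P.
    apply (mean_cderiv _ _ (D (S p))); [apply ccont_mul; [apply ccont_const | exact P] |].
    now rewrite circle_inv_2PI.
  - intros E; apply (f_equal Im) in E; cbn [Im Czero] in E.
    pose proof (lt_0_INR (S p) ltac:(lia)); lra.
Qed.

(** Cauchy's theorem for [e^{zw}]. For [z <> 0] the integrand is, up to the factor [i z], the
    derivative of [e^{zw}] in [t]; for [z = 0] it is [w], treated directly. *)
Lemma mean_exp_circle (r : R) (z : Cplx) :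
  mean (fun t => Cmul (Cexp (Cmul z (circle r t))) (circle r t)) = Czero.
Proof.
  assert (c : ccont (circle r)) by apply ccont_circle.
  assert (ce : ccont (fun t => Cexp (Cmul z (circle r t))))
    by (apply ccont_exp, ccont_mul; [apply ccont_const | exact c]).
  destruct (excluded_middle_informative (z = Czero)) as [-> | Hz].
  - rewrite (mean_ext _ (circle r)).
    2:{ intros t; replace (Cmul Czero (circle r t)) with Czero by ring; rewrite Cexp_0; ring. }
    apply (Cmul_integral (mkC 0 1)); [| intros E; injection E; lra].
    rewrite <- mean_mul_l by exact c.
    apply (mean_cderiv _ _ (cderiv_circle r)); [apply ccont_mul; [apply ccont_const | exact c] |].
    apply circle_2PI.
  - apply (Cmul_integral (mkC 0 1)); [| intros E; injection E; lra].
    apply (Cmul_integral z); [| exact Hz].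
    assert (cp : ccont (fun t => Cmul (Cexp (Cmul z (circle r t))) (circle r t))) by now apply ccont_mul.
    rewrite <- mean_mul_l by exact cp.
    rewrite <- mean_mul_l by (apply ccont_mul; [apply ccont_const | exact cp]).
    apply (mean_cderiv (fun t => Cexp (Cmul z (circle r t)))).
    + intros t.
      pose proof (cderiv_exp _ _ _
        (cderiv_mul _ _ _ _ _ (cderiv_const z t) (cderiv_circle r t))) as D.
      match type of D with cderiv _ _ ?l => match goal with |- cderiv _ _ ?l' =>
        replace l' with l by ring end end.
      exact D.
    + apply ccont_mul; [apply ccont_const | apply ccont_mul; [apply ccont_const | exact cp]].
    + now rewrite circle_2PI.
Qed.

(* The integral in the definition of [Phi] at [z = 0], with [w] replaced by [w^{1-p}]. *)
Definition inv_moment (r : R) (lam : nat -> Cplx) (k p : nat) : Cplx :=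
  mean (fun t => Cmul (Cmul (circle r t) (Cpow (circle_inv r t) p)) (inv_prod lam k (circle r t))).

Lemma ccont_inv_moment (r : R) (lam : nat -> Cplx) (k p : nat) : encloses r lam k ->
  ccont (fun t => Cmul (Cmul (circle r t) (Cpow (circle_inv r t) p)) (inv_prod lam k (circle r t))).
Proof.
  intros H; apply ccont_mul; [apply ccont_mul |].
  - apply ccont_circle.
  - apply ccont_pow, ccont_circle_inv.
  - now apply ccont_inv_prod.
Qed.

(** Multiply [circle_mul_inv_prod] by [w^{-p}]; on the right [w^{-p}] is read as [w^{1-(p+1)}],
    which raises the exponent by one. *)
Lemma inv_moment_rec (r : R) (lam : nat -> Cplx) (k p : nat) : encloses r lam (S k) ->
  inv_moment r lam (S k) p =
  Cadd (inv_moment r lam k (S p)) (Cmul (lam k) (inv_moment r lam (S k) (S p))).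
Proof.
  intros H; unfold inv_moment.
  rewrite <- mean_mul_l by (now apply ccont_inv_moment).
  rewrite <- mean_add.
  2: now apply ccont_inv_moment, encloses_S.
  2:{ apply ccont_mul; [apply ccont_const | now apply ccont_inv_moment]. }
  apply mean_ext; intros t.
  pose proof (circle_mul_inv_prod r t lam k H) as E.
  pose proof (circle_mul_inv r t (proj1 H)) as U.
  set (w := circle r t) in *; set (v := circle_inv r t) in *; simpl Cpow.
  set (Q := inv_prod lam (S k) w) in *; set (Q0 := inv_prod lam k w) in *.
  transitivity (Cmul (Cpow v p) (Cadd Q0 (Cmul (lam k) Q))).
  - rewrite <- E; ring.
  - transitivity (Cmul (Cmul w v) (Cmul (Cpow v p) (Cadd Q0 (Cmul (lam k) Q)))); [rewrite U |]; ring.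
Qed.

Lemma inv_moment_0_S (r : R) (lam : nat -> Cplx) (p : nat) : 0 < r ->
  inv_moment r lam 0 (S p) = mean (fun t => Cpow (circle_inv r t) p).
Proof.
  intros Hr; apply mean_ext; intros t; simpl.
  transitivity (Cmul (Cmul (circle r t) (circle_inv r t)) (Cpow (circle_inv r t) p)); [ring |].
  rewrite circle_mul_inv by exact Hr; ring.
Qed.

Lemma Cmod_Cpow u n : Cmod (Cpow u n) = Cmod u ^ n.
Proof. induction n; simpl; [apply Cmod_1 | rewrite Cmod_mul, IHn; ring]. Qed.

Lemma Cmod_inv_moment_le (r : R) (lam : nat -> Cplx) (k p : nat) : encloses r lam k ->
  Cmod (inv_moment r lam k p) <= 2 * (r * (/ r) ^ p).
Proof.
  intros H; apply Cmod_mean_le; [now apply ccont_inv_moment |].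
  intros t; rewrite !Cmod_mul, Cmod_Cpow; unfold circle_inv; destruct H as [Hr H].
  assert (0 < / r) by now apply Rinv_0_lt_compat.
  rewrite !Cmod_circle by assumption.
  rewrite <- (Rmult_1_r (r * (/ r) ^ p)) at 2.
  apply Rmult_le_compat_l; [apply Rmult_le_pos; [lra | apply pow_le; lra] |].
  apply Cmod_inv_prod_le_1; now split.
Qed.

Lemma geometric_le_eq_0 (x B q : R) : 0 <= x -> 0 <= q < 1 -> (forall m, x <= B * q ^ m) -> x = 0.
Proof.
  intros Hx Hq H.
  assert (L : is_lim_seq (fun m => B * q ^ m) 0).
  { evar_last; [apply is_lim_seq_scal_l, is_lim_seq_geom; rewrite Rabs_right; lra |].
    simpl; f_equal; ring. }
  pose proof (is_lim_seq_le (fun _ => x) _ x 0 H (is_lim_seq_const x) L) as I; simpl in I; lra.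
Qed.

(* Iterating [inv_moment_rec] gives a factor [lam k ^ m] against [r ^ - m]. *)
Lemma inv_moment_eq_0_step (r : R) (lam : nat -> Cplx) (k p : nat) : encloses r lam (S k) ->
  (forall p', (p < p')%nat -> inv_moment r lam k p' = Czero) -> inv_moment r lam (S k) p = Czero.
Proof.
  intros H H0; apply Cmod_eq_0.
  destruct H as [Hr Hlam]; pose proof (Hlam k ltac:(lia)) as Hk; pose proof (Cmod_pos (lam k)).
  assert (Hi : 0 < / r) by now apply Rinv_0_lt_compat.
  (* The ratio [|lam k| / r] is below 1 because [encloses] places [lam k] strictly inside the
     circle. *)
  apply (geometric_le_eq_0 _ (2 * (r * (/ r) ^ p)) (Cmod (lam k) * / r)); [apply Cmod_pos | |].
  { split; [apply Rmult_le_pos; lra |].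
    apply (Rmult_lt_reg_r r); [exact Hr |]. rewrite Rmult_assoc, Rinv_l; lra. }
  intros m.
  assert (E : Cmod (inv_moment r lam (S k) p) = Cmod (lam k) ^ m * Cmod (inv_moment r lam (S k) (p + m))).
  { induction m as [| m IH]; [rewrite Nat.add_0_r; simpl; ring |].
    rewrite IH, inv_moment_rec by (now split); rewrite H0 by lia.
    rewrite <- plus_n_Sm; simpl.
    replace (Cadd Czero (Cmul (lam k) (inv_moment r lam (S k) (S (p + m)))))
      with (Cmul (lam k) (inv_moment r lam (S k) (S (p + m)))) by ring.
    rewrite Cmod_mul; ring. }
  rewrite E, Rpow_mult_distr.
  assert (I := Cmod_inv_moment_le r lam (S k) (p + m) (conj Hr Hlam)).
  rewrite pow_add in I.
  assert (J : 0 <= Cmod (lam k) ^ m) by now apply pow_le.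
  nra.
Qed.

Lemma inv_moment_0_eq_0 (r : R) (lam : nat -> Cplx) (p : nat) : 0 < r ->
  (1 < p)%nat -> inv_moment r lam 0 p = Czero.
Proof.
  intros Hr Hp; destruct p as [| [| p]]; try lia.
  rewrite inv_moment_0_S by exact Hr; apply mean_circle_inv_pow.
Qed.

(** As a contour integral the integrand [w^{-p} / prod (w - lam j)] decays at least like [w^{-2}],
    so the residue at infinity is 0. The proof stays on one circle and inducts on the number of
    factors, starting from the negative powers of [w]. *)
Lemma inv_moment_S_eq_0 (r : R) (lam : nat -> Cplx) (k : nat) : encloses r lam (S k) ->
  forall p, (0 < p)%nat -> inv_moment r lam (S k) p = Czero.
Proof.
  induction k as [| k IH]; intros H p Hp; apply inv_moment_eq_0_step; auto; intros p' Hp'.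
  - apply inv_moment_0_eq_0; [apply H | lia].
  - apply IH; [now apply encloses_S | lia].
Qed.

Lemma inv_moment_1_0 (r : R) (lam : nat -> Cplx) : encloses r lam 1 -> inv_moment r lam 1 0 = Cone.
Proof.
  intros H; rewrite inv_moment_rec by exact H.
  rewrite inv_moment_S_eq_0 by (auto with arith).
  rewrite inv_moment_0_S by apply H.
  rewrite (mean_ext _ (fun _ => Cone)) by (intros; reflexivity).
  rewrite mean_const; ring.
Qed.

Lemma inv_moment_SS_0 (r : R) (lam : nat -> Cplx) (k : nat) : encloses r lam (S (S k)) ->
  inv_moment r lam (S (S k)) 0 = Czero.
Proof.
  intros H; apply inv_moment_eq_0_step; [exact H |].
  intros p Hp; apply inv_moment_S_eq_0; [now apply encloses_S | exact Hp].
Qed.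

(** The contour integral with [k] factors at the point [s z]: the real parameter [s] runs along the
    segment from 0 to [z], and [s = 1] gives the value of interest. *)
Definition contour (r : R) (lam : nat -> Cplx) (k : nat) (z : Cplx) (s : R) : Cplx :=
  mean (fun t => Cmul (Cexp (Cmul (mkC s 0) (Cmul z (circle r t))))
                      (Cmul (circle r t) (inv_prod lam k (circle r t)))).

Lemma contour_0 (r : R) (lam : nat -> Cplx) (k : nat) (z : Cplx) :
  contour r lam k z 0 = inv_moment r lam k 0.
Proof.
  apply mean_ext; intros t; simpl.
  replace (Cmul (mkC 0 0) (Cmul z (circle r t))) with Czero by (apply Cplx_ext; simpl; ring).
  rewrite Cexp_0; ring.
Qed.

Lemma contour_no_pole (r : R) (lam : nat -> Cplx) (z : Cplx) (s : R) : contour r lam 0 z s = Czero.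
Proof.
  rewrite <- (mean_exp_circle r (Cmul (mkC s 0) z)); apply mean_ext; intros t; simpl.
  replace (Cmul (Cmul (mkC s 0) z) (circle r t)) with (Cmul (mkC s 0) (Cmul z (circle r t))) by ring.
  ring.
Qed.

(** Differentiation under the integral brings down [z w], and [circle_mul_inv_prod] absorbs the
    [w]. *)
Lemma cderiv_contour (r : R) (lam : nat -> Cplx) (k : nat) (z : Cplx) (s : R) :
  encloses r lam (S k) ->
  cderiv (contour r lam (S k) z) s
    (Cmul z (Cadd (contour r lam k z s) (Cmul (lam k) (contour r lam (S k) z s)))).
Proof.
  intros H.
  assert (c : ccont (circle r)) by apply ccont_circle.
  assert (cz : ccont (fun t => Cmul z (circle r t))) by (apply ccont_mul; [apply ccont_const | exact c]).
  assert (ce : ccont (fun t => Cexp (Cmul (mkC s 0) (Cmul z (circle r t)))))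
    by (apply ccont_exp, ccont_mul; [apply ccont_const | exact cz]).
  assert (c1 : ccont (fun t => Cmul (circle r t) (inv_prod lam (S k) (circle r t))))
    by (apply ccont_mul; [exact c | now apply ccont_inv_prod]).
  assert (c0 : ccont (fun t => Cmul (circle r t) (inv_prod lam k (circle r t))))
    by (apply ccont_mul; [exact c | now apply ccont_inv_prod, encloses_S]).
  pose proof (cderiv_mean_exp _ _ s cz c1) as D.
  match type of D with cderiv _ _ ?l => match goal with |- cderiv _ _ ?l' =>
    replace l' with l; [exact D |] end end.
  unfold contour.
  rewrite <- (mean_mul_l (lam k)) by now apply ccont_mul.
  rewrite <- mean_add.
  2: now apply ccont_mul.
  2: apply ccont_mul; [apply ccont_const | now apply ccont_mul].
  rewrite <- mean_mul_l.
  2:{ apply ccont_add; [now apply ccont_mul | apply ccont_mul; [apply ccont_const | now apply ccont_mul]]. }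
  apply mean_ext; intros t; pose proof (circle_mul_inv_prod r t lam k H) as E.
  set (e := Cexp _); set (w := circle r t) in *; set (Q := inv_prod lam (S k) w) in *.
  transitivity (Cmul (Cmul e (Cmul z w)) (Cadd (inv_prod lam k w) (Cmul (lam k) Q)));
    [rewrite <- E |]; ring.
Qed.

(** This is the fundamental function for the equally spaced exponents [c, c + g, ..., c + g k], the
    extreme case of [|lam j| <= c + g j]. *)
Definition exp_majorant (c g : R) (k : nat) (x : R) : R :=
  exp (c * x) * ((exp (g * x) - 1) / g) ^ k / INR (fact k).

Lemma is_derive_exp_majorant_0 (c g x : R) : 0 < g ->
  is_derive (exp_majorant c g 0) x (0 + c * exp_majorant c g 0 x).
Proof. intros Hg; unfold exp_majorant; simpl; auto_derive; [trivial | field]. Qed.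

Lemma is_derive_exp_majorant_S (c g : R) (k : nat) (x : R) : 0 < g ->
  is_derive (exp_majorant c g (S k)) x (exp_majorant c g k x + (c + g * INR (S k)) * exp_majorant c g (S k) x).
Proof.
  intros Hg; unfold exp_majorant.
  auto_derive; [trivial |].
  pose proof (INR_fact_neq_0 k); pose proof (not_0_INR (S k) ltac:(lia)).
  (* The factorials and successors reduced by [auto_derive] are folded back, so that [field] sees
     [INR (S k)] and [INR (fact k)] as atoms. *)
  change (INR (fact (S k))) with (INR (S k * fact k)).
  change (INR (fact k + k * fact k)) with (INR (S k * fact k)).
  change (match k with O => 1 | S _ => INR k + 1 end) with (INR (S k)).
  rewrite mult_INR; simpl pow; unfold Rdiv, Rminus.
  set (N := INR (S k)) in *; set (Y := _ ^ k); field; repeat split; auto; lra.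
Qed.

(** Induction on [k]: the bound at one stage controls the forcing term of the next equation. At the
    first stage the forcing term is 0 and the initial value is 1; later initial values are 0. *)
Lemma Cmod_contour_le (r c g : R) (lam : nat -> Cplx) (z : Cplx) :
  0 < g -> (forall j, Cmod (lam j) <= c + g * INR j) ->
  forall k, encloses r lam (S k) -> forall s, 0 <= s <= 1 ->
  Cmod (contour r lam (S k) z s) <= exp_majorant c g k (s * Cmod z).
Proof.
  intros Hg Hlam; induction k as [| k IH]; intros H.
  - apply (linear_ode_comparison _ (contour r lam 0 z) z (lam 0%nat) (exp_majorant c g 0) (fun _ => 0) c).
    + intros s; now apply cderiv_contour.
    + intros x; now apply is_derive_exp_majorant_0.
    + intros s _; rewrite contour_no_pole, Cmod_0; lra.
    + specialize (Hlam 0%nat); simpl in Hlam; lra.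
    + rewrite contour_0, inv_moment_1_0, Cmod_1 by exact H.
      unfold exp_majorant; simpl; rewrite Rmult_0_r, exp_0; lra.
  - apply (linear_ode_comparison _ (contour r lam (S k) z) z (lam (S k)) (exp_majorant c g (S k)) (exp_majorant c g k) (c + g * INR (S k))).
    + intros s; now apply cderiv_contour.
    + intros x; now apply is_derive_exp_majorant_S.
    + apply IH, encloses_S, H.
    + apply Hlam.
    + rewrite contour_0, inv_moment_SS_0, Cmod_0 by exact H.
      unfold exp_majorant; rewrite !Rmult_0_r, exp_0; unfold Rdiv; simpl; lra.
Qed.

(** Nonvanishing is carried through the induction because [Cinv_mul] splits only nonzero factors. *)
Lemma Cinv_Cprodn (r t : R) (lam : nat -> Cplx) (n : nat) : encloses r lam (S n) ->
  Cprodn (fun j => Csub (circle r t) (lam j)) n <> Czero /\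
  Cinv (Cprodn (fun j => Csub (circle r t) (lam j)) n) = inv_prod lam (S n) (circle r t).
Proof.
  induction n as [| n IH]; intros H.
  - split; simpl; [| ring].
    apply Cmod_ge_1_neq0, (Cmod_circle_sub _ _ _ 1); [exact H | lia].
  - destruct (IH (encloses_S _ _ _ H)) as [I1 I2].
    assert (N : Csub (circle r t) (lam (S n)) <> Czero)
      by (apply Cmod_ge_1_neq0, (Cmod_circle_sub _ _ _ (S (S n))); [exact H | lia]).
    cbn [Cprodn]; split.
    + intros E; apply N; now apply (Cmul_integral _ _ E).
    + rewrite Cinv_mul, I2 by assumption; reflexivity.
Qed.

(** The radius grows with [n], but it may stay existential because the bound in [Cmod_contour_le]
    does not involve it. *)
Lemma Phi_contour (lam : nat -> Cplx) (n : nat) (z : Cplx) :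
  exists r, encloses r lam (S n) /\ Phi lam n z = contour r lam (S n) z 1.
Proof.
  set (r := 1 + sum_f_R0 (fun j => Cmod (lam j)) n); exists r.
  assert (H : encloses r lam (S n)).
  { assert (P : forall m, 0 <= sum_f_R0 (fun j => Cmod (lam j)) m)
      by (intros m; apply cond_pos_sum; intros; apply Cmod_pos).
    split; [unfold r; specialize (P n); lra |].
    intros j Hj; unfold r; clear r.
    enough (Cmod (lam j) <= sum_f_R0 (fun j => Cmod (lam j)) n) by lra.
    induction n as [| n IH]; simpl.
    - replace j with 0%nat by lia; lra.
    - destruct (Nat.eq_dec j (S n)) as [-> | N].
      + specialize (P n); lra.
      + specialize (IH ltac:(lia)); pose proof (Cmod_pos (lam (S n))); lra. }
  split; [exact H |].
  (* Continuity of the integrand identifies the integrals in [Phi], chosen by [epsilon], with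
     [RInt.RInt]. *)
  assert (c : ccont (fun t => Cmul (Cmul (Cexp (Cmul z (circle r t))) (circle r t))
                      (Cinv (Cprodn (fun j => Csub (circle r t) (lam j)) n)))).
  { pose proof (ccont_circle r) as c.
    apply ccont_mul; [apply ccont_mul; [apply ccont_exp, ccont_mul; [apply ccont_const |] |] |]; auto.
    destruct (ccont_inv_prod r lam (S n) H) as [c1 c2]; split;
      [refine (continuity_ext _ _ _ c1) | refine (continuity_ext _ _ _ c2)];
      intros t; now rewrite (proj2 (Cinv_Cprodn r t lam n H)). }
  transitivity (mean (fun t => Cmul (Cmul (Cexp (Cmul z (circle r t))) (circle r t))
                      (Cinv (Cprodn (fun j => Csub (circle r t) (lam j)) n)))).
  - destruct c as [c1 c2]; unfold Phi; fold r.
    rewrite !Defs_RInt; [reflexivity | apply (continuity_ex_RInt _ _ _ c2) | apply (continuity_ex_RInt _ _ _ c1)].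
  - apply mean_ext; intros t; rewrite (proj2 (Cinv_Cprodn r t lam n H)).
    replace (Cmul (mkC 1 0) (Cmul z (circle r t))) with (Cmul z (circle r t))
      by (apply Cplx_ext; simpl; ring).
    ring.
Qed.

Lemma Cmod_Phi_le (c g : R) (lam : nat -> Cplx) (n : nat) (z : Cplx) :
  0 < g -> (forall j, Cmod (lam j) <= c + g * INR j) ->
  Cmod (Phi lam n z) <= exp_majorant c g n (Cmod z).
Proof.
  intros Hg Hlam; destruct (Phi_contour lam n z) as (r & H & ->).
  pose proof (Cmod_contour_le r c g lam z Hg Hlam n H 1 ltac:(lra)) as I.
  now rewrite Rmult_1_l in I.
Qed.

(** * Convergence of the series *)

(** The explicit remainder depends on [u] only through [B], [q] and [N], which makes convergence
    uniform when [u] varies with a point. *)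
Lemma geometric_tail (u : nat -> R) (B q : R) (N : nat) : 0 <= q < 1 ->
  (forall n, (n >= N)%nat -> Rabs (u n) <= B * q ^ n) ->
  forall m, (m >= N)%nat -> Rabs (sum_f_R0 u m - Series u) <= B * q ^ S m / (1 - q).
Proof.
  intros Hq Hu m Hm.
  assert (Hq' : Rabs q < 1) by (rewrite Rabs_right; lra).
  assert (T : forall k, Rabs (u (S m + k)%nat) <= B * q ^ S m * q ^ k).
  { intros k; rewrite Rmult_assoc, <- pow_add; apply Hu; lia. }
  assert (G : ex_series (fun k => B * q ^ S m * q ^ k))
    by (apply (@ex_series_scal R_AbsRing R_NormedModule), ex_series_geom, Hq').
  assert (A : ex_series (fun k => Rabs (u (S m + k)%nat))).
  { apply (@ex_series_le R_AbsRing R_CompleteNormedModule _ _) with (2 := G); intros k.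
    unfold norm; simpl; unfold abs; simpl; rewrite Rabs_Rabsolu; apply T. }
  rewrite (Series_incr_n u (S m)); [| lia |].
  2:{ apply (ex_series_incr_n u (S m)).
      apply (@ex_series_le R_AbsRing R_CompleteNormedModule _ _) with (2 := G); exact T. }
  simpl pred.
  match goal with |- Rabs (?a - (?a + ?b)) <= _ => replace (a - (a + b)) with (- b) by ring end.
  rewrite Rabs_Ropp; eapply Rle_trans; [apply Series_Rabs, A |].
  eapply Rle_trans.
  - apply Series_le; [| exact G]; intros k; split; [apply Rabs_pos | apply T].
  - rewrite Series_scal_l, Series_geom by exact Hq'; apply Rle_refl.
Qed.

Lemma geometric_tail_small (B q eps : R) : 0 <= q < 1 -> eps > 0 ->
  exists N, forall m, (m >= N)%nat -> B * q ^ S m / (1 - q) < eps.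
Proof.
  intros Hq He.
  assert (L : is_lim_seq (fun m => B / (1 - q) * q ^ m) 0).
  { evar_last; [apply is_lim_seq_scal_l, is_lim_seq_geom; rewrite Rabs_right; lra |].
    simpl; f_equal; ring. }
  apply is_lim_seq_spec in L; destruct (L (mkposreal eps He)) as [N HN]; simpl in HN.
  exists N; intros m Hm; specialize (HN (S m) ltac:(lia)).
  rewrite Rminus_0_r in HN; apply Rabs_lt_between in HN.
  replace (B * q ^ S m / (1 - q)) with (B / (1 - q) * q ^ S m) by (field; lra); apply HN.
Qed.

Lemma Csumn_Re_Im (f : nat -> Cplx) (m : nat) :
  Csumn f m = mkC (sum_f_R0 (fun n => Re (f n)) m) (sum_f_R0 (fun n => Im (f n)) m).
Proof. induction m; simpl; [now destruct (f 0%nat) | now rewrite IHm]. Qed.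

Lemma Weierstrass_M_test (f : nat -> Cplx -> Cplx) (K : Cplx -> Prop) (B q : R) (N : nat) :
  0 <= q < 1 -> (forall n z, (n >= N)%nat -> K z -> Cmod (f n z) <= B * q ^ n) ->
  abs_series_unif_cv_on f K /\ Cseries_unif_cv_on f K.
Proof.
  intros Hq Hf; split.
  - exists (fun z => Series (fun n => Cmod (f n z))); intros eps He.
    destruct (geometric_tail_small B q eps Hq He) as [M HM].
    exists (max N M); intros m z Hm Kz.
    eapply Rle_lt_trans; [apply (geometric_tail _ B q N Hq) | apply HM; lia]; [| lia].
    intros n Hn; rewrite Rabs_right by (apply Rle_ge, Cmod_pos); now apply Hf.
  - exists (fun z => mkC (Series (fun n => Re (f n z))) (Series (fun n => Im (f n z)))).
    intros eps He.
    destruct (geometric_tail_small B q (eps / 2) Hq ltac:(lra)) as [M HM].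
    exists (max N M); intros m z Hm Kz; rewrite Csumn_Re_Im.
    specialize (HM m ltac:(lia)).
    eapply Rle_lt_trans; [apply Cmod_le_Rabs_plus |]; simpl Re; simpl Im.
    assert (Rabs (sum_f_R0 (fun n => Re (f n z)) m - Series (fun n => Re (f n z))) <= B * q ^ S m / (1 - q)).
    { apply (geometric_tail _ B q N Hq); [| lia].
      intros n Hn; eapply Rle_trans; [apply Rabs_Re_le_Cmod | now apply Hf]. }
    assert (Rabs (sum_f_R0 (fun n => Im (f n z)) m - Series (fun n => Im (f n z))) <= B * q ^ S m / (1 - q)).
    { apply (geometric_tail _ B q N Hq); [| lia].
      intros n Hn; eapply Rle_trans; [apply Rabs_Im_le_Cmod | now apply Hf]. }
    lra.
Qed.

(** * Explicit constants from the upper limits and from compactness *)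

Lemma nroot_nonneg (x : R) (n : nat) : 0 <= nroot x n.
Proof.
  unfold nroot; destruct (Req_EM_T x 0); [lra |]; unfold Rpower; apply Rlt_le, exp_pos.
Qed.

Lemma nroot_le_pow (x M : R) (n : nat) : 0 <= x -> (0 < n)%nat -> nroot x n <= M -> x <= M ^ n.
Proof.
  intros Hx Hn H; pose proof (nroot_nonneg x n) as P.
  eapply Rle_trans; [| apply pow_incr; split; [exact P | exact H]].
  unfold nroot; destruct (Req_EM_T x 0) as [-> | N].
  - apply pow_le; lra.
  - pose proof (lt_0_INR n Hn).
    rewrite <- Rpower_pow by (unfold Rpower; apply exp_pos).
    rewrite Rpower_mult, Rinv_l, Rpower_1; lra.
Qed.

(** If no [b n] bounds the distances, pick points of [K] beyond each [b n]; by monotonicity a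
    subsequential limit lies at distance at least every [b n]. With [b] increasing to a radius this
    puts [K] into a smaller closed disc. *)
Lemma compact_bound_or_attained (K : Cplx -> Prop) (x0 : Cplx) (b : nat -> R) : Ccompact K ->
  (forall n m, (n <= m)%nat -> b n <= b m) ->
  (exists n, forall z, K z -> Cmod (Csub z x0) <= b n) \/
  (exists z, K z /\ forall n, b n <= Cmod (Csub z x0)).
Proof.
  intros HK Hb.
  destruct (excluded_middle_informative (exists n, forall z, K z -> Cmod (Csub z x0) <= b n))
    as [H | H]; [now left | right].
  assert (S : forall n, exists z, K z /\ b n < Cmod (Csub z x0)).
  { intros n; apply Classical_Prop.NNPP; intros H'; apply H; exists n; intros z Kz.
    apply Rnot_lt_le; intros L; apply H'; now exists z. }
  set (s := fun n => proj1_sig (constructive_indefinite_description _ (S n))).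
  assert (Hs : forall n, K (s n) /\ b n < Cmod (Csub (s n) x0))
    by (intros n; exact (proj2_sig (constructive_indefinite_description _ (S n)))).
  destruct (HK s (fun n => proj1 (Hs n))) as (phi & l & Hphi & Kl & Hl).
  assert (Hge : forall n, (n <= phi n)%nat).
  { induction n as [| n IH]; [lia | specialize (Hphi n); lia]. }
  exists l; split; [exact Kl |]; intros n.
  apply Rnot_lt_le; intros L.
  destruct (Hl (b n - Cmod (Csub l x0)) ltac:(lra)) as [N HN].
  specialize (HN (max n N) ltac:(lia)); specialize (Hge (max n N)).
  destruct (Hs (phi (max n N))) as [_ I].
  pose proof (Hb n (phi (max n N)) ltac:(lia)).
  pose proof (Cmod_triangle (Csub (s (phi (max n N))) l) (Csub l x0)) as T.
  replace (Cadd (Csub (s (phi (max n N))) l) (Csub l x0))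
    with (Csub (s (phi (max n N))) x0) in T by ring.
  lra.
Qed.

(** For [L > 0], [rho < ln (1 + beta / L) / beta] means [L (e^{beta rho} - 1) < beta]. The second
    form has no division by [L] and also covers [L = 0], the infinite radius. *)
Lemma compact_radius (beta L : R) (x0 : Cplx) (K : Cplx -> Prop) : beta > 0 -> Ccompact K ->
  (forall z, K z -> L = 0 \/ (L > 0 /\ Cmod (Csub z x0) < ln (1 + beta / L) / beta)) ->
  exists rho, 0 <= rho /\ L * (exp (beta * rho) - 1) < beta /\
    forall z, K z -> Cmod (Csub z x0) <= rho.
Proof.
  intros Hb HK H.
  assert (Z : L * (exp (beta * 0) - 1) < beta) by (rewrite Rmult_0_r, exp_0; lra).
  destruct (excluded_middle_informative (exists z, K z)) as [[z0 K0] | E].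
  2:{ exists 0; repeat split; [lra | exact Z |]; intros z Kz; exfalso; eauto. }
  destruct (Req_EM_T L 0) as [-> | NL].
  - destruct (compact_bound_or_attained K x0 INR HK) as [[n Hn] | (z & _ & Hz)].
    + intros n m I; now apply le_INR.
    + exists (INR n); repeat split; [apply pos_INR | lra | exact Hn].
    + destruct (INR_unbounded (Cmod (Csub z x0))) as [n Hn]; specialize (Hz n); lra.
  - assert (HL : L > 0) by (destruct (H z0 K0); tauto).
    assert (H' : forall z, K z -> Cmod (Csub z x0) < ln (1 + beta / L) / beta)
      by (intros z Kz; destruct (H z Kz); tauto).
    set (r := ln (1 + beta / L) / beta) in *.
    assert (Hr : forall rho, rho < r -> L * (exp (beta * rho) - 1) < beta).
    { intros rho I.
      assert (P : 0 < beta / L) by now apply Rdiv_lt_0_compat.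
      assert (J : exp (beta * rho) < 1 + beta / L).
      { rewrite <- (exp_ln (1 + beta / L)) by lra; apply exp_increasing.
        replace (ln (1 + beta / L)) with (beta * r) by (unfold r; field; lra).
        now apply Rmult_lt_compat_l. }
      replace beta with (L * (beta / L)) at 2 by (field; lra).
      apply Rmult_lt_compat_l; lra. }
    destruct (compact_bound_or_attained K x0 (fun n => r - / (INR n + 1)) HK)
      as [[n Hn] | (z & Kz & Hz)].
    + intros n m I; apply le_INR in I; pose proof (pos_INR n).
      apply Rplus_le_compat_l, Ropp_le_contravar, Rinv_le_contravar; lra.
    + assert (0 < / (INR n + 1)) by (apply Rinv_0_lt_compat; pose proof (pos_INR n); lra).
      exists (r - / (INR n + 1)); repeat split; [| apply Hr; lra | exact Hn].
      specialize (Hn z0 K0); pose proof (Cmod_pos (Csub z0 x0)); lra.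
    + specialize (H' z Kz).
      (* A point at distance at least every [r - 1/(n+1)] would be at distance at least [r], against
         [H']. *)
      destruct (archimed_cor1 (r - Cmod (Csub z x0)) ltac:(lra)) as (n & Hn & n0).
      specialize (Hz n); simpl in Hz.
      apply lt_0_INR in n0.
      assert (/ (INR n + 1) < / INR n) by (apply Rinv_lt_contravar; nra).
      lra.
Qed.

(** A strict inequality between continuous functions of the perturbation persists for small positive
    values, so one [eps] serves both [L] and [beta]. *)
Lemma enlarge_rates (beta L rho : R) : L * (exp (beta * rho) - 1) < beta ->
  exists eps, eps > 0 /\ (L + eps) * (exp ((beta + eps) * rho) - 1) < beta + eps.
Proof.
  intros H.
  set (f := fun e => beta + e - (L + e) * (exp ((beta + e) * rho) - 1)).
  assert (C : continuous f 0).
  { apply (@ex_derive_continuous R_AbsRing R_NormedModule); unfold f; auto_derive; trivial. }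
  assert (P : 0 < f 0) by (unfold f; rewrite !Rplus_0_r; lra).
  apply continuity_pt_filterlim in C.
  destruct (C (f 0) P) as (d & Hd & HC); simpl in HC; unfold R_dist in HC.
  exists (d / 2); split; [lra |].
  specialize (HC (d / 2)).
  assert (I : Rabs (f (d / 2) - f 0) < f 0).
  { apply HC; split; [split; [exact Logic.I | lra] |]. rewrite Rminus_0_r, Rabs_right; lra. }
  apply Rabs_def2 in I; unfold f in *; lra.
Qed.

(** The slack [g - beta] gives [|lam j| <= g j] beyond some [N]; the sum of the moduli up to [N]
    serves as [c] for the remaining indices. *)
Lemma affine_bound (lam : nat -> Cplx) (beta g : R) : 0 <= g -> beta < g ->
  limsup_le (fun n => Cmod (lam n) / INR n) beta ->
  exists c, forall j, Cmod (lam j) <= c + g * INR j.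
Proof.
  intros Hg Hb H; destruct (H (g - beta) ltac:(lra)) as [N HN].
  exists (sum_f_R0 (fun j => Cmod (lam j)) N); intros j.
  assert (P : forall m, 0 <= sum_f_R0 (fun j => Cmod (lam j)) m)
    by (intros m; apply cond_pos_sum; intros; apply Cmod_pos).
  destruct (le_lt_dec j N) as [I | I].
  - assert (Cmod (lam j) <= sum_f_R0 (fun j => Cmod (lam j)) N).
    { clear HN; induction N as [| N IH]; simpl.
      - replace j with 0%nat by lia; lra.
      - destruct (Nat.eq_dec j (S N)) as [-> | D].
        + specialize (P N); lra.
        + specialize (IH ltac:(lia)); pose proof (Cmod_pos (lam (S N))); lra. }
    pose proof (Rmult_le_pos _ _ Hg (pos_INR j)); lra.
  - specialize (HN j ltac:(lia)); simpl in HN.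
    assert (J : 0 < INR j) by (apply lt_0_INR; lia).
    apply (Rmult_le_compat_r (INR j)) in HN; [| lra].
    unfold Rdiv in HN; rewrite Rmult_assoc, Rinv_l, Rmult_1_r in HN by lra.
    specialize (P N); lra.
Qed.

Lemma exp_majorant_le (c g : R) (k : nat) (x y : R) : 0 <= c -> 0 < g -> 0 <= x <= y ->
  exp_majorant c g k x <= exp_majorant c g k y.
Proof.
  intros Hc Hg Hx; unfold exp_majorant.
  assert (E : forall a, 0 <= a -> exp (a * x) <= exp (a * y)).
  { intros a Ha; destruct (Req_EM_T (a * x) (a * y)) as [-> | N]; [lra |].
    left; apply exp_increasing; pose proof (Rmult_le_compat_l a x y Ha (proj2 Hx)); lra. }
  assert (E0 : 1 <= exp (g * x)).
  { pose proof (exp_ineq1_le (g * x)); pose proof (Rmult_le_pos g x); lra. }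
  assert (0 < / g) by now apply Rinv_0_lt_compat.
  assert (0 <= (exp (g * x) - 1) / g) by (apply Rmult_le_pos; lra).
  apply Rmult_le_compat_r; [apply Rlt_le, Rinv_0_lt_compat, INR_fact_lt_0 |].
  apply Rmult_le_compat; [apply Rlt_le, exp_pos | now apply pow_le | now apply E |].
  apply pow_incr; split; [assumption |].
  apply Rmult_le_compat_r; [lra |]; pose proof (E g ltac:(lra)); lra.
Qed.

(** The real number [L] stands for [1/R^*]: its finiteness expresses [R^* > 0], and [L = 0] is the
    case [R^* = oo], where [K] is any compact set. *)
Theorem mainTheorem7 (beta : R) (lam a : nat -> Cplx) (L : R) (x0 : Cplx) :
  beta > 0 ->
  limsup_le (fun n => Cmod (lam n) / INR n) beta ->
  is_limsup (fun n => nroot (Cmod (a n) / INR (fact n)) n) L ->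
  forall K : Cplx -> Prop,
    Ccompact K ->
    (forall z, K z ->
       L = 0 \/ (L > 0 /\ Cmod (Csub z x0) < ln (1 + beta / L) / beta)) ->
    abs_series_unif_cv_on (fun n z => Cmul (a n) (Phi lam n (Csub z x0))) K /\
    Cseries_unif_cv_on (fun n z => Cmul (a n) (Phi lam n (Csub z x0))) K.
Proof.
  intros Hb Hlam [Ha _] K HK HKz.
  destruct (compact_radius beta L x0 K Hb HK HKz) as (rho & Hrho & Hlt & HKrho).
  destruct (enlarge_rates beta L rho Hlt) as (eps & He & Hq).
  set (g := beta + eps) in *; assert (Hg : 0 < g) by (unfold g; lra).
  destruct (affine_bound lam beta g ltac:(lra) ltac:(unfold g; lra) Hlam) as [c Hc].
  assert (c0 : 0 <= c).
  { specialize (Hc 0%nat); simpl in Hc; pose proof (Cmod_pos (lam 0%nat)); lra. }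
  destruct (Ha eps He) as [N HN].
  assert (HL : 0 < L + eps) by (eapply Rle_lt_trans; [apply nroot_nonneg | apply (HN N); lia]).
  set (h := (exp (g * rho) - 1) / g).
  assert (Hh : 0 <= h).
  { pose proof (exp_ineq1_le (g * rho)); pose proof (Rmult_le_pos g rho).
    apply Rmult_le_pos; [lra | apply Rlt_le, Rinv_0_lt_compat, Hg]. }
  (* The ratio [(L + eps) h] is below 1 by the choice of [eps]. Starting at [S N] excludes [n = 0],
     where the root bound says nothing about [a n]. *)
  apply (Weierstrass_M_test _ K (exp (c * rho)) ((L + eps) * h) (S N)).
  - split; [apply Rmult_le_pos; lra |].
    unfold h; apply (Rmult_lt_reg_r g); [exact Hg |].
    unfold Rdiv; rewrite <- Rmult_assoc, Rmult_assoc, Rinv_l by lra; lra.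
  - intros n z Hn Kz; rewrite Cmod_mul.
    assert (F : 0 < INR (fact n)) by apply INR_fact_lt_0.
    assert (An : Cmod (a n) / INR (fact n) <= (L + eps) ^ n).
    { apply nroot_le_pow; [| lia | left; apply HN; lia].
      apply Rmult_le_pos; [apply Cmod_pos | apply Rlt_le, Rinv_0_lt_compat, F]. }
    assert (Pn : Cmod (Phi lam n (Csub z x0)) <= exp (c * rho) * h ^ n / INR (fact n)).
    { eapply Rle_trans; [apply (Cmod_Phi_le c g); assumption |].
      apply exp_majorant_le; auto; split; [apply Cmod_pos | now apply HKrho]. }
    rewrite Rpow_mult_distr.
    (* The [n!] in the bound for [|a n|] cancels the [1/n!] in the bound for [Phi]. *)
    replace (exp (c * rho) * ((L + eps) ^ n * h ^ n)) with
      (((L + eps) ^ n * INR (fact n)) * (exp (c * rho) * h ^ n / INR (fact n))) by (field; lra).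
    apply Rmult_le_compat; try apply Cmod_pos; [| exact Pn].
    apply (Rmult_le_reg_r (/ INR (fact n))); [apply Rinv_0_lt_compat, F |].
    rewrite Rmult_assoc, Rinv_r by lra; unfold Rdiv in An; lra.
Qed.
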